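(* Let $G=(V,E)$ be a minimally $d$-rigid graph with at least $d+1$ vertices and let $G'$ be obtained from $G$ by a $d$-dimensional spider-split. Then $r_d(G')\ge r_d(G)$.
   Context: A $d$-dimensional spider-split takes a graph $G$, a vertex $x$, and a partition of the neighbourhood of $x$ into sets $N_1$, $N_2$ and $\{w_1,\dots,w_d\}$; it outputs the graph obtained from $G-x$ by adding new vertices $x_1,x_2$, with $x_i$ joined to all of $N_i$ ($i=1,2$) and both joined to each of $w_1,\dots,w_d$ (no edge $x_1x_2$). On $\mathbb{R}^d$, $\|\cdot\|$ is the Euclidean norm. A realisation $p:V\to\mathbb{R}^d$ is generic if its coordinates are algebraically independent over $\mathbb{Q}$; realisations are equivalent if all edge lengths agree, congruent if related by an isometry. $G$ is $d$-rigid if some generic framework is rigid, minimally $d$-rigid if moreover $G-e$ is not $d$-rigid for all edges $e$. $r_d(G)$ is the maximum over generic $p:V\to\mathbb{R}^d$ of the number of congruence classes of real realisations equivalent to $p$. *)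

(* Defs.v *)
From HB Require Import structures.
From mathcomp Require Import all_boot all_order all_algebra.
From mathcomp Require Import Rstruct.
From mathcomp Require Import mpoly.
From Stdlib Require Import Rdefinitions.

Set Implicit Arguments.
Unset Strict Implicit.
Unset Printing Implicit Defensive.

Import Order.TTheory GRing.Theory Num.Theory.
Local Open Scope ring_scope.

Definition simple_graph (V : finType) (adj : rel V) : Prop :=
  ssrbool.symmetric adj /\ ssrbool.irreflexive adj.

Definition del_edge (V : finType) (adj : rel V) (a b : V) : rel V :=
  fun u v => adj u v && ~~ (((u == a) && (v == b)) || ((u == b) && (v == a))).

Definition nbhd (V : finType) (adj : rel V) (x : V) : {set V} :=
  [set y | adj x y].

(* Vertex set of the output: option V, where  Some v  (v <> x) is the  *)
(* old vertex v, Some x plays the role of the new vertex x_1 and None  *)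
(* plays the role of the new vertex x_2.                               *)

Definition spider_partition (V : finType) (adj : rel V) (d : nat) (x : V)
    (N1 N2 W : {set V}) : Prop :=
  [/\ N1 :|: N2 :|: W = nbhd adj x,
      [disjoint N1 & N2], [disjoint N1 & W], [disjoint N2 & W]
    & #|W| = d].

Definition spider_split (V : finType) (adj : rel V) (x : V)
    (N1 N2 W : {set V}) : rel (option V) :=
  fun a b =>
    match a, b with
    | Some u, Some v =>
        if u == x then (v != x) && (v \in N1 :|: W)
        else if v == x then u \in N1 :|: W
        else adj u v
    | Some u, None => (u != x) && (u \in N2 :|: W)
    | None, Some v => (v != x) && (v \in N2 :|: W)
    | None, None => false
    end.

Definition point (d : nat) := 'rV[R]_d.

Definition enorm (d : nat) (a : point d) : R :=
  Num.sqrt (\sum_(i < d) (a ord0 i) ^+ 2).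

Definition realisation (V : finType) (d : nat) := V -> point d.

Definition equivalent (V : finType) (adj : rel V) (d : nat)
    (p q : realisation V d) : Prop :=
  forall u v, adj u v -> enorm (p u - p v) = enorm (q u - q v).

Definition isometry (d : nat) (f : point d -> point d) : Prop :=
  forall a b, enorm (f a - f b) = enorm (a - b).

Definition congruent (V : finType) (d : nat) (p q : realisation V d) : Prop :=
  exists f, isometry f /\ forall v, q v = f (p v).

Definition coords (V : finType) (d : nat) (p : realisation V d)
    (k : 'I_#|{: V * 'I_d}|) : R :=
  let vi := enum_val k in p vi.1 ord0 vi.2.

Definition generic (V : finType) (d : nat) (p : realisation V d) : Prop :=
  forall P : {mpoly rat[#|{: V * 'I_d}|]},
    P != 0 -> (map_mpoly (ratr : rat -> R) P).@[coords p] != 0.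

Definition rigid_framework (V : finType) (adj : rel V) (d : nat)
    (p : realisation V d) : Prop :=
  exists eps : R, 0 < eps /\
    forall q : realisation V d, equivalent adj p q ->
      (forall v, enorm (q v - p v) < eps) -> congruent p q.

Definition d_rigid (V : finType) (adj : rel V) (d : nat) : Prop :=
  exists p : realisation V d, generic p /\ rigid_framework adj p.

Definition minimally_d_rigid (V : finType) (adj : rel V) (d : nat) : Prop :=
  d_rigid adj d /\ forall a b, adj a b -> ~ d_rigid (del_edge adj a b) d.

(* r_d(G) = max over generic p of the number of congruence classes of  *)
(* realisations equivalent to p, a value in N u {oo}.  We encode it by *)
(* its lower sets:  r_ge adj d n  <->  r_d(G) >= n, i.e. there is a    *)
(* generic p and n pairwise non-congruent realisations equivalent to p. *)
Definition r_ge (V : finType) (adj : rel V) (d n : nat) : Prop :=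
  exists p : realisation V d, generic p /\
    exists qs : 'I_n -> realisation V d,
      (forall i, equivalent adj p (qs i)) /\
      (forall i j, i != j -> ~ congruent (qs i) (qs j)).

(* Main.v *)
(** Let [q] be equivalent to the generic realisation [p], and let [q'] put both
    new vertices at [q x].  If the edges of [G] are independent at [q] and the
    vectors [q x - q w_j] are linearly independent, then the edges of [G'] are
    independent at [q'], so near [q'] the edge lengths of [G'] can be
    prescribed arbitrarily.  Hence for a generic realisation close to the
    doubled [p], every [q'] can be corrected to an equivalent realisation, and
    non-congruence survives a small perturbation.

    Both properties of [q] are transferred from a generic rigid [p0] through
    polynomial identities.  Minimality says that the length of [e] is
    transcendental over the lengths of [G - e] (otherwise [G - e] would be
    rigid, as [e] could only take finitely many lengths); this depends only on
    the lengths, so it holds at [q], and a derivation of the field of reals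
    killing the other lengths and mapping that of [e] to [1], applied to the
    coordinates of [q], is a velocity moving only [e].  The Gram determinant of
    the [q x - q w_j] is algebraic over the edge lengths by infinitesimal
    rigidity of [p0]; the constant term of an algebraic equation for it is a
    nonzero function of the lengths of [p], so the determinant cannot vanish
    at [q]. *)
From Stdlib Require Import Rdefinitions Raxioms.
From HB Require Import structures.
From mathcomp Require Import all_boot all_order all_algebra.
From mathcomp Require Import Rstruct boolp classical_sets mpoly.
From mathcomp Require Import zify ring lra.
Require Import Defs.

Set Implicit Arguments.
Unset Strict Implicit.
Unset Printing Implicit Defensive.

Import Order.TTheory GRing.Theory Num.Theory.
Local Open Scope ring_scope.
(* Otherwise arguments of type [R] would be parsed with Stdlib's operations. *)
Local Bind Scope ring_scope with R.

(** * Extension of derivations *)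

Section DualSubrings.
Variable K : numFieldType.
Implicit Types (G : K -> K -> Prop) (P Q : {poly K}).

(* [G a a'] encodes membership of [a + eps a'] in a set of dual numbers. *)
Record dual_subring G : Prop := DualSubring {
  dual1 : G 1 0;
  dualB : forall a a' b b', G a a' -> G b b' -> G (a - b) (a' - b');
  dualM : forall a a' b b', G a a' -> G b b' -> G (a * b) (a' * b + a * b') }.

(** For a subring this says that each [a] has at most one [a']. *)
Definition dual_functional G : Prop := forall w, G 0 w -> w = 0.

Definition dual_poly G P Q : Prop := forall k, G P`_k Q`_k.

(** The pair is [P + eps Q] evaluated at [b + eps w], so this is the subring generated by [G] and
    [b + eps w]. *)
Definition dual_adjoin G (b w : K) : K -> K -> Prop := fun a a' =>
  exists P Q, [/\ dual_poly G P Q, a = P.[b] & a' = P^`().[b] * w + Q.[b]].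

Section Closure.
Variables (G : K -> K -> Prop) (hG : dual_subring G).

Lemma dual0 : G 0 0.
Proof. by have := dualB hG (dual1 hG) (dual1 hG); rewrite !subrr. Qed.

Lemma dualD a a' b b' : G a a' -> G b b' -> G (a + b) (a' + b').
Proof.
move=> ha hb; have := dualB hG ha (dualB hG dual0 hb).
by rewrite !sub0r !opprK.
Qed.

Lemma dual_sum (I : Type) (r : seq I) (f f' : I -> K) :
  (forall i, G (f i) (f' i)) -> G (\sum_(i <- r) f i) (\sum_(i <- r) f' i).
Proof.
move=> h; elim: r => [|i r IH]; first by rewrite !big_nil; exact: dual0.
by rewrite !big_cons; apply: dualD.
Qed.

Lemma dualMn a a' n : G a a' -> G (a *+ n) (a' *+ n).
Proof.
move=> h; elim: n => [|n IH]; first exact: dual0.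
by rewrite !mulrS; apply: dualD.
Qed.

Lemma dual_polyB P P' Q Q' :
  dual_poly G P P' -> dual_poly G Q Q' -> dual_poly G (P - Q) (P' - Q').
Proof. by move=> hP hQ k; rewrite !coefB; apply: dualB. Qed.

Lemma dual_polyM P P' Q Q' : dual_poly G P P' -> dual_poly G Q Q' ->
  dual_poly G (P * Q) (P' * Q + P * Q').
Proof.
move=> hP hQ k; rewrite coefD !coefM -big_split /=.
by apply: dual_sum => i; apply: dualM.
Qed.

Lemma dual_polyC a a' : G a a' -> dual_poly G a%:P a'%:P.
Proof. by move=> h k; rewrite !coefC; case: ifP => // _; exact: dual0. Qed.

Lemma dual_polyXn n : dual_poly G 'X^n 0.
Proof.
move=> k; rewrite coefXn coef0.
by case: eqP => _; [exact: dual1 | exact: dual0].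
Qed.

Lemma dual_poly_deriv P Q : dual_poly G P Q -> dual_poly G P^`() Q^`().
Proof. by move=> h k; rewrite !coef_deriv; apply: dualMn. Qed.

Lemma dual_adjoin_subring b w : dual_subring (dual_adjoin G b w).
Proof.
split.
- exists 1%:P, 0%:P; split; first exact/dual_polyC/(dual1 hG).
  + by rewrite hornerC.
  + by rewrite derivC !hornerC mul0r addr0.
- move=> _ _ _ _ [P [P' [hP -> ->]]] [Q [Q' [hQ -> ->]]].
  exists (P - Q), (P' - Q'); split; first exact: dual_polyB.
  + by rewrite !hornerE.
  + by rewrite derivB !(hornerD, hornerN); ring.
- move=> _ _ _ _ [P [P' [hP -> ->]]] [Q [Q' [hQ -> ->]]].
  exists (P * Q), (P' * Q + P * Q'); split; first exact: dual_polyM.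
  + by rewrite !hornerE.
  + by rewrite derivM !(hornerD, hornerM); ring.
Qed.

Lemma sub_dual_adjoin b w a a' : G a a' -> dual_adjoin G b w a a'.
Proof.
move=> h; exists a%:P, a'%:P; split; first exact: dual_polyC.
  by rewrite hornerC.
by rewrite derivC !hornerC mul0r add0r.
Qed.

Lemma dual_adjoin_gen b w : dual_adjoin G b w b w.
Proof.
exists 'X, 0; split; first by rewrite -(expr1 'X); exact: dual_polyXn.
  by rewrite hornerX.
by rewrite derivX !hornerC mul1r addr0.
Qed.

Hypothesis Ginj : dual_functional G.

Lemma dual_poly0 Q : dual_poly G 0 Q -> Q = 0.
Proof.
by move=> h; apply/polyP => k; have := h k; rewrite !coef0 => /Ginj.
Qed.

Lemma deriv_neq0 P : (1 < size P)%N -> P^`() != 0.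
Proof.
move=> hs; apply/negP => /eqP/polyP/(_ (size P).-2).
have e : (size P).-2.+1 = (size P).-1 by case: (size P) hs => [|[|n]].
rewrite coef_deriv coef0 e => /eqP; rewrite mulrn_eq0 -e /= e -lead_coefE.
by rewrite lead_coef_eq0 -size_poly_eq0; case: (size P) hs.
Qed.

(* For [b] algebraic, [w] is dictated by the minimal polynomial of [b]; the
   conclusion propagates to other polynomials by pseudo-division. *)
Lemma dual_extension b : exists w, dual_functional (dual_adjoin G b w).
Proof.
pose ann n := `[< exists P Q,
  [/\ dual_poly G P Q, P != 0, P.[b] = 0 & size P = n] >].
have [[n hn]|nann] := pselect (exists n, ann n); last first.
  (* When [b] is transcendental over the first components of [G], the value of [w] is
     unconstrained. *)
  exists 0 => _ [P [Q [hPQ /esym Pb ->]]].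
  have P0 : P = 0.
    have [//|Pn0] := eqVneq P 0; case: nann.
    by exists (size P); apply/asboolP; exists P, Q.
  by move: hPQ; rewrite P0 => /dual_poly0 ->; rewrite deriv0 !hornerC mul0r addr0.
have {n hn} [m /asboolP[M [M' [hM Mn0 Mb sM]]] minm] := ex_minnP (ex_intro _ n hn).
have sM1 : (1 < size M)%N.
  rewrite ltnNge; apply/negP => /size1_polyC MC.
  by move: Mb Mn0; rewrite MC hornerC => ->; rewrite eqxx.
have dMb : M^`().[b] != 0.
  apply/eqP => dMb; have := minm (size M^`()).
  rewrite -sM leqNgt lt_size_deriv // => /(_ _)/notF; apply.
  apply/asboolP; exists M^`(), M'^`(); split=> //; first exact: dual_poly_deriv.
  exact: deriv_neq0.
exists (- M'.[b] / M^`().[b]) => _ [P [Q [hPQ /esym Pb ->]]].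
set w := _ / _.
have Mw : M^`().[b] * w + M'.[b] = 0 by rewrite /w; field.
elim/ltn_ind: {P}(size P) {-2}P (erefl (size P)) Q hPQ Pb => s IH P sP Q hPQ Pb.
have [P0|Pn0] := eqVneq P 0.
  by move: hPQ; rewrite P0 => /dual_poly0 ->; rewrite deriv0 !hornerC mul0r addr0.
have ms : (size M <= size P)%N.
  by rewrite sM minm //; apply/asboolP; exists P, Q.
pose e := (size P - size M)%N.
have sPgt0 : (0 < size P)%N by rewrite size_poly_gt0.
(* One step of pseudo-division: [c * P - l * 'X^e * M] loses the leading term, and the primed
   constants lift the same combination to second components. *)
pose c := (lead_coef M)%:P; pose l := (lead_coef P)%:P.
pose c' := (M'`_(size M).-1)%:P; pose l' := (Q`_(size P).-1)%:P.
have hc : dual_poly G c c' by apply: dual_polyC; exact: hM.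
have hl : dual_poly G l l' by apply: dual_polyC; exact: hPQ.
have := dual_polyB (dual_polyM hc hPQ) (dual_polyM (dual_polyM hl (dual_polyXn e)) hM).
set P2 := (X in dual_poly G X _); set Q2 := (X in dual_poly G _ X) => h2.
have sP2 : (size P2 < s)%N.
  rewrite -sP -(prednK sPgt0) ltnS; apply/leq_sizeP => j hj.
  have [->|jn] := eqVneq j (size P).-1; last first.
    have hj2 : (size P <= j)%N.
      by rewrite -(prednK sPgt0) ltn_neqAle eq_sym jn hj.
    rewrite coefB /c /l -mulrA mulrC coefMC coefCM coefXnM.
    rewrite ltnNge (leq_trans (leq_subr _ _) hj2) /= !nth_default ?mul0r ?mulr0 ?subrr //.
    by rewrite leq_subRL ?(leq_trans (leq_subr _ _) hj2) // addnC subnKC.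
  rewrite coefB /c /l -mulrA mulrC coefMC coefCM coefXnM.
  have -> : ((size P).-1 < e)%N = false.
    apply/negbTE; rewrite -leqNgt -ltnS prednK // /e ltn_subrL.
    by rewrite (ltn_trans _ sM1).
  have -> : ((size P).-1 - e)%N = (size M).-1.
    rewrite /e -!subn1; have := ms; have := sM1; have := sPgt0.
    by move: (size P) (size M) => a b'; lia.
  by rewrite -!lead_coefE mulrC subrr.
have P2b : P2.[b] = 0 by rewrite !hornerE Pb Mb !mulr0 subrr.
have := IH _ sP2 _ (erefl _) _ h2 P2b.
rewrite /P2 /Q2 /c /l /c' /l' derivB !derivM !derivC.
rewrite !(hornerD, hornerN, hornerM, hornerC, hornerXn) Pb Mb => h.
have : lead_coef M * (P^`().[b] * w + Q.[b]) = 0.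
  rewrite -(mulr0 (lead_coef P * b ^+ e)) -[in RHS]Mw -[RHS]add0r.
  rewrite -[X in _ = X + _]h; ring.
by move/eqP; rewrite mulf_eq0 lead_coef_eq0 (negbTE Mn0) => /eqP.
Qed.

End Closure.

Definition derivation (D : K -> K) : Prop :=
  (forall a b, D (a - b) = D a - D b) /\
  (forall a b, D (a * b) = D a * b + a * D b).

(* Maximal single-valued subrings of the dual numbers are graphs of
   derivations defined everywhere. *)
Lemma total_derivation G : dual_subring G -> dual_functional G ->
  exists D, derivation D /\ forall a a', G a a' -> D a = a'.
Proof.
move=> hG Ginj.
pose good G2 := [/\ dual_subring G2, dual_functional G2
                  & forall a a', G a a' -> G2 a a'].
pose T := {G2 | good G2}.
pose le (A B : T) := `[< forall a a', sval A a a' -> sval B a a' >].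
have [|||A totA|[G2 [hG2 G2inj GG2]] maxG2] := @Zorn T le.
- by move=> A; apply/asboolP.
- by move=> A B C /asboolP AB /asboolP BC; apply/asboolP => a a' /AB /BC.
- move=> [A hA] [B hB] /asboolP /= AB /asboolP /= BA; apply: eq_exist.
  by apply/funext => a; apply/funext => a'; apply/propext; split=> [/AB|/BA].
- have [[B0 AB0]|nA] := pselect (exists B, A B); last first.
    have hG0 : good G by split.
    by exists (exist _ G hG0) => B AB; case: nA; exists B.
  pose U a a' := exists2 B : T, A B & sval B a a'.
  have common (B C : T) : A B -> A C -> exists2 B', A B' &
      (forall a a', sval B a a' -> sval B' a a') /\
      (forall a a', sval C a a' -> sval B' a a').
    by move=> AB AC; have [/asboolP h|/asboolP h] := totA _ _ AB AC; [exists C|exists B].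
  have hU : good U.
    split.
    + split.
      * by exists B0 => //; case: (svalP B0) => h _ _; exact: dual1.
      * move=> a a' b b' [B AB Ba] [C AC Cb].
        have [B' AB' [h1 h2]] := common B C AB AC; exists B' => //.
        by case: (svalP B') => h _ _; apply: (dualB h); [exact: h1|exact: h2].
      * move=> a a' b b' [B AB Ba] [C AC Cb].
        have [B' AB' [h1 h2]] := common B C AB AC; exists B' => //.
        by case: (svalP B') => h _ _; apply: (dualM h); [exact: h1|exact: h2].
    + by move=> w [B AB Bw]; case: (svalP B) => _ h _; exact: h.
    + by move=> a a' h; exists B0 => //; case: (svalP B0) => _ _; exact.
  by exists (exist _ U hU) => B AB; apply/asboolP => a a' h /=; exists B.
(* Adjoining any [a] to a maximal subring adds nothing, so [a] already has a lift. *)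
have tot a : exists a', G2 a a'.
  have [w hw] := dual_extension hG2 G2inj a.
  have hG3 : good (dual_adjoin G2 a w).
    split=> //; first exact: dual_adjoin_subring.
    by move=> b b' /GG2; exact: sub_dual_adjoin.
  have le3 : le (exist good G2 (And3 hG2 G2inj GG2)) (exist good _ hG3).
    by apply/asboolP => b b' /=; exact: sub_dual_adjoin.
  have e := congr1 (fun A : T => sval A) (maxG2 _ le3).
  by exists w; rewrite /= in e; rewrite -e; exact: dual_adjoin_gen.
have [D hD] := choice tot; exists D.
have uniqD a a' : G2 a a' -> D a = a'.
  by move=> h; have := dualB hG2 (hD a) h; rewrite subrr => /G2inj/eqP; rewrite subr_eq0 => /eqP.
split; last by move=> a a' /GG2 /uniqD.
split=> a b; apply: uniqD; [exact: dualB|exact: dualM].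
Qed.

(** Give [S] zero derivative and adjoin [b + eps]. The result is single-valued because [P.[b] = 0]
    forces [P = 0], so no constraint falls on the derivative of [b]. *)
Lemma derivation_transcendental (S : K -> Prop) (b : K) :
  S 1 -> (forall a c, S a -> S c -> S (a - c)) ->
  (forall a c, S a -> S c -> S (a * c)) ->
  (forall P, (forall k, S P`_k) -> P.[b] = 0 -> P = 0) ->
  exists D, [/\ derivation D, forall a, S a -> D a = 0 & D b = 1].
Proof.
move=> S1 SB SM trb.
pose G (a a' : K) := S a /\ a' = 0.
have hG : dual_subring G.
  split=> // [a a' c c'|a a' c c'] [? ->] [? ->]; split; rewrite ?subrr //; auto.
  by rewrite mul0r mulr0 addr0.
have Ginj : dual_functional (dual_adjoin G b 1).
  move=> w [P [Q [hPQ Pb ->]]].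
  have -> : Q = 0 by apply/polyP => k; rewrite coef0; case: (hPQ k).
  have -> : P = 0 by apply: trb => // k; case: (hPQ k).
  by rewrite deriv0 !hornerC mul0r addr0.
have [D [hD DG]] := total_derivation (dual_adjoin_subring hG b 1) Ginj.
exists D; split=> //; last exact/DG/dual_adjoin_gen.
by move=> a Sa; apply/DG/sub_dual_adjoin.
Qed.

(** * Derivations of sums, products and determinants *)

Section DerivationTheory.
Variables (D : K -> K) (hD : derivation D).

Lemma derivation0 : D 0 = 0.
Proof. by have := hD.1 0 0; rewrite !subrr. Qed.

Lemma derivationB a b : D (a - b) = D a - D b. Proof. exact: hD.1. Qed.

Lemma derivationM a b : D (a * b) = D a * b + a * D b. Proof. exact: hD.2. Qed.

Lemma derivationN a : D (- a) = - D a.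
Proof. by rewrite -sub0r derivationB derivation0 sub0r. Qed.

Lemma derivationD a b : D (a + b) = D a + D b.
Proof. by rewrite -{1}[b]opprK derivationB derivationN opprK. Qed.

Lemma derivation1 : D 1 = 0.
Proof.
have := derivationM 1 1; rewrite !mulr1 mul1r => /eqP.
by rewrite -subr_eq0 opprD addrA subrr sub0r oppr_eq0 => /eqP.
Qed.

Lemma derivation_sum (I : Type) (r : seq I) (f : I -> K) :
  D (\sum_(i <- r) f i) = \sum_(i <- r) D (f i).
Proof. exact: (big_morph D derivationD derivation0). Qed.

Lemma derivation_prod0 (I : Type) (r : seq I) (f : I -> K) :
  (forall i, D (f i) = 0) -> D (\prod_(i <- r) f i) = 0.
Proof.
move=> h; elim: r => [|i r IH]; first by rewrite big_nil derivation1.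
by rewrite big_cons derivationM h IH mul0r mulr0 addr0.
Qed.

Lemma derivation_sign n : D ((-1) ^+ n) = 0.
Proof.
rewrite -signr_odd; case: (odd n); rewrite ?expr0 ?expr1 ?derivationN derivation1 //.
by rewrite oppr0.
Qed.

Lemma derivation_det0 n (A : 'M[K]_n) :
  (forall i j, D (A i j) = 0) -> D (\det A) = 0.
Proof.
move=> h; rewrite derivation_sum big1 // => s _.
rewrite derivationM derivation_prod0 => [|i]; last exact: h.
by rewrite derivation_sign mul0r mulr0 addr0.
Qed.

End DerivationTheory.
End DualSubrings.

(** * Fixed points of contractions *)

Lemma le_pow2_eq0 (x C : R) : 0 <= x -> (forall n, x <= C / 2 ^+ n) -> x = 0.
Proof.
move=> x0 h; apply/eqP; rewrite eq_le x0 andbT leNgt; apply/negP => xgt0.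
pose n := Num.bound (C / x).
have C0 : 0 <= C by have := h 0%N; rewrite expr0 divr1; exact: le_trans.
have hn : C / x < 2 ^+ n.
  apply: lt_le_trans (archi_boundP _) _; first by rewrite divr_ge0.
  by rewrite -natrX ler_nat ltnW // ltn_expl.
have := h n; rewrite leNgt => /negP; apply.
by rewrite ltr_pdivrMr ?exprn_gt0 // mulrC -ltr_pdivrMr.
Qed.

(** The intervals of radius [C / 2 ^+ n] around [u n] meet pairwise, so the supremum of their left
    ends lies in all of them. *)
Lemma geometric_limit (u : nat -> R) (C : R) :
  (forall n, `|u n.+1 - u n| <= C / 2 ^+ n.+1) ->
  exists l, forall n, `|l - u n| <= C / 2 ^+ n.
Proof.
move=> hu.
have h2 n : 2 ^+ n != 0 :> R by rewrite expf_neq0 // pnatr_eq0.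
have tail k n : `|u (k + n)%N - u n| <= C / 2 ^+ n - C / 2 ^+ (k + n).
  elim: k => [|k IH]; first by rewrite !subrr normr0.
  have -> : u (k.+1 + n)%N - u n = (u (k + n).+1 - u (k + n)%N) + (u (k + n)%N - u n).
    by rewrite addSn; ring.
  apply: le_trans (ler_normD _ _) _; apply: le_trans (lerD (hu _) IH) _.
  by rewrite le_eqVlt; apply/orP; left; apply/eqP; rewrite addSn exprS; field; rewrite ?h2.
have cross m n : u m - C / 2 ^+ m <= u n + C / 2 ^+ n.
  have C0 k : 0 <= C / 2 ^+ k.
    have := le_trans (normr_ge0 _) (hu 0%N).
    by rewrite pmulr_lge0 ?invr_gt0 ?exprn_gt0 // => ?; rewrite divr_ge0 ?exprn_ge0.
  have [mn|nm] := leqP m n.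
    have := tail (n - m)%N m; rewrite subnK // ler_norml => /andP[h _].
    by move: (C0 n) (C0 m) => ? ?; lra.
  have := tail (m - n)%N n; rewrite subnK 1?ltnW // ler_norml => /andP[_ h].
  by move: (C0 n) (C0 m) => ? ?; lra.
have [||l [ubl lubl]] := completeness (fun x => exists n, x = u n - C / 2 ^+ n).
- by exists (u 0%N + C / 2 ^+ 0) => _ [n ->]; apply/RleP.
- by exists (u 0%N - C / 2 ^+ 0), 0%N.
exists l => n; rewrite ler_norml; apply/andP; split.
  have h : u n - C / 2 ^+ n <= l by apply/RleP; apply: ubl; exists n.
  by lra.
have h : l <= u n + C / 2 ^+ n.
  by apply/RleP; apply: lubl => _ [m ->]; apply/RleP.
by lra.
Qed.

(** Banach's theorem for the sup norm on the cube of radius [r], by iteration from the origin. *)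
Lemma contraction_fixpoint (I : finType) (T : (I -> R) -> I -> R) (r : R) :
  0 <= r ->
  (forall z, (forall i, `|z i| <= r) -> forall i, `|T z i| <= r) ->
  (forall z z' t, (forall i, `|z i| <= r) -> (forall i, `|z' i| <= r) ->
     (forall i, `|z i - z' i| <= t) -> forall i, `|T z i - T z' i| <= t / 2) ->
  exists2 z, (forall i, `|z i| <= r) & forall i, T z i = z i.
Proof.
move=> r0 Tball Tcontr.
pose z n := iter n T (fun=> 0).
have zb n : forall i, `|z n i| <= r.
  by elim: n => [|n IH] i; rewrite /z /= ?normr0 //; exact: Tball.
(* The constant is [2 * r] because the first step, of size at most [r], is compared with [C / 2]. *)
have zd n i : `|z n.+1 i - z n i| <= (2 * r) / 2 ^+ n.+1.
  elim: n i => [|n IH] i.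
    by rewrite expr1 subr0; apply: le_trans (zb 1%N i) _; lra.
  apply: le_trans (Tcontr (z n.+1) (z n) _ (zb _) (zb _) IH i) _.
  by rewrite [in leRHS]exprS invfM mulrA mulrAC.
have [l hl] := choice (fun i => geometric_limit (fun n => zd n i)).
have {}hl i n : `|l i - z n i| <= 2 * r / 2 ^+ n by exact: hl.
have lb i : `|l i| <= r.
  rewrite leNgt; apply/negP => h.
  have : `|l i| - r = 0; last by move=> ?; lra.
  apply: (@le_pow2_eq0 _ (2 * r)) => [|n]; first by lra.
  have := ler_normD (l i - z n i) (z n i); rewrite subrK.
  by move: (hl i n) (zb n i) => ? ? ?; lra.
exists l => // i; apply/eqP; rewrite -subr_eq0 -normr_eq0; apply/eqP.
apply: (@le_pow2_eq0 _ (4 * r)) => // n.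
have h1 := Tcontr l (z n) _ lb (zb n) (fun i => hl i n) i.
have h2 := hl i n.+1; rewrite /z iterS -/(z n) in h2.
have := ler_distD (T (z n) i) (T l i) (l i).
rewrite [`|T (z n) i - l i|]distrC.
have -> : 4 * r / 2 ^+ n = 2 * r / 2 ^+ n / 2 + 2 * r / 2 ^+ n.+1 + 2 * r / 2 ^+ n.
  by rewrite exprS; field; rewrite expf_neq0 ?pnatr_eq0.
have : 0 <= 2 * r / 2 ^+ n by rewrite divr_ge0 ?exprn_ge0 ?mulr_ge0.
by move=> ? ?; lra.
Qed.

(** * Density of generic realisations *)

(** Cantor's nested intervals: step [n] keeps an outer third that misses [u n]. *)
Lemma interval_avoids_sequence (u : nat -> R) (a b : R) : a < b ->
  exists2 x, a <= x <= b & forall n, u n <> x.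
Proof.
move=> ab.
pose step n (I : R * R) : R * R := if u n < (I.1 + I.2) / 2
  then ((I.1 + 2 * I.2) / 3, I.2) else (I.1, (2 * I.1 + I.2) / 3).
pose fix I n := if n is n'.+1 then step n' (I n') else (a, b).
have Ilt n : (I n).1 < (I n).2.
  elim: n => [//|n IH] /=; rewrite /step.
  by case: ifP => _ /=; lra.
have Imono n : (I n).1 <= (I n.+1).1 /\ (I n.+1).2 <= (I n).2.
  rewrite /= /step; have := Ilt n.
  by case: ifP => _ /= ?; split; lra.
have mono1 m n : (m <= n)%N -> (I m).1 <= (I n).1.
  move/subnK <-; elim: (n - m)%N => [//|k IH].
  by apply: le_trans IH _; rewrite addSn; case: (Imono (k + m)%N).
have mono2 m n : (m <= n)%N -> (I n).2 <= (I m).2.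
  move/subnK <-; elim: (n - m)%N => [//|k IH].
  by apply: le_trans _ IH; rewrite addSn; case: (Imono (k + m)%N).
have cross m n : (I m).1 <= (I n).2.
  apply: le_trans (mono1 _ _ (leq_maxl m n)) _.
  by apply: le_trans (ltW (Ilt _)) _; apply: mono2; exact: leq_maxr.
have [||x [ubx lubx]] := completeness (fun x => exists n, x = (I n).1).
- by exists b => _ [n ->]; apply/RleP; exact: (cross n 0%N).
- by exists a, 0%N.
have Ix n : (I n).1 <= x <= (I n).2.
  apply/andP; split; apply/RleP; first by apply: ubx; exists n.
  by apply: lubx => _ [m ->]; apply/RleP.
exists x => [|n unx]; first exact: (Ix 0%N).
have := Ix n.+1; have := Ilt n; rewrite /= /step -unx.
by case: (ltrP (u n)) => /= h1 h2 /andP[h3 h4]; lra.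
Qed.

Section FiniteRoots.
Variables (K : eqType) (A : idomainType) (f : K -> A).

(** Linear factors are split off one at a time. The map [f] restricts attention to roots of a given
    shape, such as the constants of a polynomial ring. *)
Lemma finite_roots (P : {poly A}) : P != 0 -> injective f ->
  exists s : seq K, forall b, root P (f b) -> b \in s.
Proof.
move=> P0 finj.
elim/ltn_ind: {P}(size P) {-2}P (erefl (size P)) P0 => n IH P sP P0.
have [[b Pb]|nr] := pselect (exists b, root P (f b)); last first.
  by exists [::] => b Pb; case: nr; exists b.
have /factor_theorem[Q PQ] := Pb.
have Q0 : Q != 0 by apply: contraNneq P0 => Q0; rewrite PQ Q0 mul0r.
have [|s hs] := IH (size Q) _ Q (erefl _) Q0.
  by rewrite -sP PQ size_Mmonic ?monicXsubC // size_XsubC addn2.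
exists (b :: s) => c; rewrite PQ rootM root_XsubC inE => /orP[/hs ->|].
  by rewrite orbT.
by move/eqP/finj ->; rewrite eqxx.
Qed.
End FiniteRoots.

(** * Substitution for the last variable *)

Section LastVariable.
Variables (K : idomainType) (n : nat).
Implicit Type P : {mpoly K[n.+1]}.

(** A left inverse of [muni], serving to show that [muni] is injective. *)
Definition unmuni : {poly {mpoly K[n]}} -> {mpoly K[n.+1]} :=
  fun Q => (map_poly (@mwiden n K) Q).['X_ord_max].

Lemma muni_eq0 P : muni P = 0 -> P = 0.
Proof.
move=> P0; suff <- : unmuni (muni P) = P.
  by rewrite /unmuni P0 rmorph0 horner0.
rewrite /unmuni muniE rmorph_sum horner_sum [RHS]mpolyE; apply: eq_bigr => m _.
rewrite -mul_polyC rmorphM /= map_polyC map_polyXn /= hornerM hornerC hornerXn.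
rewrite mwidenZ mwidenX -scalerAl [in RHS]mpolyXE_id big_ord_recr /=; congr (_ *: (_ * _)).
rewrite mpolyXE_id big_ord_recr /= mnmwiden_ordmax expr0 mulr1.
by apply: eq_bigr => i _; rewrite mnmwiden_widen mnmE.
Qed.

Definition msubst_last (b : K) P : {mpoly K[n]} := (muni P).[b%:MP].

Definition extend_point (v : 'I_n -> K) (b : K) (i : 'I_n.+1) : K :=
  if unlift ord_max i is Some j then v j else b.

Lemma meval_msubst_last P v b :
  (msubst_last b P).@[v] = P.@[extend_point v b].
Proof.
rewrite /msubst_last muniE horner_sum raddf_sum mevalE; apply: eq_bigr => m _ /=.
rewrite -mul_polyC hornerM hornerC hornerXn -scalerAl mevalZ; congr (_ * _).
rewrite mevalM mevalX rmorphXn /= mevalC big_ord_recr /=; congr (_ * _ ^+ _).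
  apply: eq_bigr => i _; rewrite mnmE /extend_point; congr (_ ^+ _).
  have -> : widen_ord (leqnSn n) i = lift ord_max i.
    by apply: val_inj; rewrite /= /bump leqNgt ltn_ord.
  by rewrite liftK.
by rewrite /extend_point unlift_none.
Qed.
End LastVariable.

(** Induction on the number of variables: each [P k] vanishes identically for only finitely many
    constants in the last variable, so some nearby constant avoids these countably many values for
    all [k] at once. *)
Lemma dense_nonvanishing n (P : nat -> {mpoly R[n]}) (a : 'I_n -> R) (e : R) :
  0 < e -> (forall k, P k != 0) ->
  exists2 b, (forall i, `|b i - a i| < e) & forall k, (P k).@[b] != 0.
Proof.
move=> e0; elim: n P a => [|n IH] P a P0.
  by exists a => [[]//|k]; have := P0 k; rewrite [P k]nvar0_mpolyC mpolyC_eq0 mevalC.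
have rootsP k : exists s : seq R, forall b, root (muni (P k)) b%:MP -> b \in s.
  apply: finite_roots => [|x y /(congr1 (mcoeff 0%MM))]; last by rewrite !mpolyCK.
  by apply/eqP => /muni_eq0/eqP; exact/negP.
have [s hs] := choice rootsP.
(* Enumerates all exceptional constants; the default [0] only excludes one more value. *)
pose u m := if @unpickle (nat * nat)%type m is Some kj then nth 0 (s kj.1) kj.2 else 0.
have le_ab : a ord_max - e / 2 < a ord_max + e / 2 by lra.
have [x xab ux] := interval_avoids_sequence u le_ab.
have [k|b hb Pb] := IH (fun k => msubst_last x (P k)) (fun i => a (lift ord_max i)).
  apply/negP => /eqP Pk; have xs : x \in s k by apply: hs; apply/rootP.
  apply: (ux (pickle (k, index x (s k)))).
  by rewrite /u pickleK /= nth_index.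
exists (extend_point b x) => [i|k]; last by rewrite -meval_msubst_last.
rewrite /extend_point; case: unliftP => [j ->|->]; first exact: hb.
by case/andP: xab => h1 h2; rewrite ltr_norml; apply/andP; split; lra.
Qed.

Lemma ratr_neq0 n (P : {mpoly rat[n]}) :
  P != 0 -> map_mpoly (ratr : rat -> R) P != 0.
Proof.
apply: contraNneq => P0; apply/eqP/mpolyP => m; apply: (@fmorph_inj _ _ (ratr : rat -> R)).
by rewrite -mcoeff_map_mpoly P0 !mcoeff0 rmorph0.
Qed.

Lemma generic_dense (V : finType) d (p : realisation V d) (e : R) : 0 < e ->
  exists2 p', generic p' & forall v i, `|p' v ord0 i - p v ord0 i| < e.
Proof.
move=> e0; set N := #|{: V * 'I_d}|.
pose code (P : {mpoly rat[N]}) : seq (rat * 'X_{1..N}) := [seq (P@_m, m) | m <- msupp P].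
pose decode s : {mpoly rat[N]} := \sum_(t <- s) t.1 *: 'X_[t.2].
have codeK P : decode (code P) = P by rewrite /decode big_map /= -mpolyE.
(* Rational polynomials are countable through their coefficient lists. Codes of no polynomial or of
   zero become [1], so that every [F k] is nonzero. *)
pose F k : {mpoly rat[N]} := if unpickle k is Some s then
  (if decode s == 0 then 1 else decode s) else 1.
have F0 k : map_mpoly (ratr : rat -> R) (F k) != 0.
  apply: ratr_neq0; rewrite /F; case: unpickle => [s|]; last exact: oner_neq0.
  by case: ifP => [_|/negbT //]; exact: oner_neq0.
have [b hb Fb] := dense_nonvanishing (coords p) e0 F0.
pose p' : realisation V d := fun v => \row_i b (enum_rank (v, i)).
have p'b : coords p' =1 b.
  by move=> k; rewrite /coords mxE -surjective_pairing enum_valK.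
exists p' => [P P0|v i].
  rewrite (meval_eq _ p'b); have := Fb (pickle (code P)).
  by rewrite /F pickleK codeK (negbTE P0).
by have := hb (enum_rank (v, i)); rewrite mxE /coords enum_rankK.
Qed.

(** * Realisations and squared distances *)

Section Dot.
Variable d : nat.
Implicit Types a b c : point d.

Definition dot a b : R := \sum_(i < d) a ord0 i * b ord0 i.

Lemma dotC a b : dot a b = dot b a.
Proof. by apply: eq_bigr => i _; rewrite mulrC. Qed.

Lemma dotNl a b : dot (- a) b = - dot a b.
Proof. by rewrite -sumrN; apply: eq_bigr => i _; rewrite !mxE mulNr. Qed.

Lemma dotDl a b c : dot (a + b) c = dot a c + dot b c.
Proof. by rewrite -big_split; apply: eq_bigr => i _; rewrite !mxE mulrDl. Qed.

Lemma dotZl k a b : dot (k *: a) b = k * dot a b.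
Proof. by rewrite mulr_sumr; apply: eq_bigr => i _; rewrite !mxE mulrA. Qed.

Lemma dotNr a b : dot a (- b) = - dot a b.
Proof. by rewrite !(dotC a) dotNl. Qed.

Lemma dotDr a b c : dot a (b + c) = dot a b + dot a c.
Proof. by rewrite !(dotC a) dotDl. Qed.

Lemma dotZr k a b : dot a (k *: b) = k * dot a b.
Proof. by rewrite !(dotC a) dotZl. Qed.

Lemma dot0r a : dot a 0 = 0.
Proof. by apply: big1 => i _; rewrite mxE mulr0. Qed.

Lemma dot_sumr (I : Type) (r : seq I) (P : pred I) (f : I -> point d) a :
  dot a (\sum_(i <- r | P i) f i) = \sum_(i <- r | P i) dot a (f i).
Proof.
exact: (big_morph (dot a) (fun b c => dotDr a b c) (dot0r a)).
Qed.

Definition dotE := (dotDl, dotNl, dotZl, dotDr, dotNr, dotZr).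

Lemma dot_ge0 a : 0 <= dot a a.
Proof. by apply: sumr_ge0 => i _; rewrite -expr2 sqr_ge0. Qed.

Lemma dot_eq0 a : dot a a = 0 -> a = 0.
Proof.
move/eqP; rewrite psumr_eq0 => [/allP h|i _]; last by rewrite -expr2 sqr_ge0.
apply/rowP => i; rewrite !mxE; apply/eqP.
by have := h i (mem_index_enum i); rewrite /= -expr2 sqrf_eq0.
Qed.

Lemma enormE a : enorm a = Num.sqrt (dot a a). Proof. by []. Qed.

Lemma enorm_eq a b : enorm a = enorm b <-> dot a a = dot b b.
Proof.
rewrite !enormE; split=> [h|-> //].
by rewrite -(sqr_sqrtr (dot_ge0 a)) -(sqr_sqrtr (dot_ge0 b)) h.
Qed.

Lemma coord_le_enorm a i : `|a ord0 i| <= enorm a.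
Proof.
rewrite enormE -sqrtr_sqr ler_sqrt ?dot_ge0 // /dot (bigD1 i) //= expr2 lerDl.
by apply: sumr_ge0 => j _; rewrite -expr2 sqr_ge0.
Qed.

Lemma isometry_dot (f : point d -> point d) : isometry f <->
  forall a b, dot (f a - f b) (f a - f b) = dot (a - b) (a - b).
Proof. by split=> h a b; apply/enorm_eq; exact: h. Qed.

(** Reflection in the perpendicular bisector of [a] and [b]. *)
Lemma isometry_reflection a b : a != b -> exists f : point d -> point d,
  [/\ isometry f, f a = b &
   forall y, dot (y - a) (y - a) = dot (y - b) (y - b) -> f y = y].
Proof.
move=> ab; have [n nE] : {n | n = a - b} by exists (a - b).
have n0 : dot n n != 0 by apply: contraNneq ab => /dot_eq0/eqP; rewrite nE subr_eq0.
pose c y := (2 * dot y n - dot a a + dot b b) / dot n n.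
exists (fun y => y - c y *: n); split.
- apply/isometry_dot => y z.
  have -> : y - c y *: n - (z - c z *: n) = (y - z) - (2 * dot (y - z) n / dot n n) *: n.
    have -> : 2 * dot (y - z) n / dot n n = c y - c z by rewrite /c !dotE; field; exact: n0.
    by apply/rowP => i; rewrite !mxE; ring.
  move: (y - z) => w; rewrite !dotE (dotC n w); field; exact: n0.
- have -> : c a = 1.
    rewrite /c; have <- : dot n n = 2 * dot a n - dot a a + dot b b.
      by rewrite nE !dotE (dotC b a); ring.
    by rewrite divff.
  by rewrite scale1r nE opprB addrC subrK.
- move=> y h; have -> : c y = 0.
    rewrite /c; have -> : 2 * dot y n - dot a a + dot b b = 0; last by rewrite mul0r.
    move: h; rewrite nE !dotE (dotC a y) (dotC b y) => h'; lra.
  by rewrite scale0r subr0.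
Qed.
End Dot.

(** * Congruence and continuity through squared distances *)

Section Realisations.
Variables (V : finType) (d : nat).
Implicit Types (p q : realisation V d) (adj : rel V).

Definition sqdist p u v : R := dot (p u - p v) (p u - p v).

Lemma sqdistC p u v : sqdist p u v = sqdist p v u.
Proof. by rewrite /sqdist !dotE (dotC (p v) (p u)); ring. Qed.

Lemma equivalent_sqdist adj p q :
  equivalent adj p q <-> forall u v, adj u v -> sqdist p u v = sqdist q u v.
Proof. by split=> h u v /h /enorm_eq. Qed.

(** For the converse, vertices are matched one by one. A misplaced image is corrected by a
    reflection, which fixes the points already matched since they are equidistant from the wrong and
    the right position. *)
Lemma congruent_sqdist p q :
  congruent p q <-> forall u v, sqdist p u v = sqdist q u v.
Proof.
split=> [[f [/isometry_dot fi fp]] u v|h].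
  by rewrite /sqdist !fp fi.
suff H (s : seq V) : exists f, isometry f /\ forall v, v \in s -> q v = f (p v).
  by have [f [fi fp]] := H (enum V); exists f; split=> // v; apply: fp; rewrite mem_enum.
elim: s => [|w s [f [fi fp]]]; first by exists id.
have [fw|fw] := eqVneq (f (p w)) (q w).
  by exists f; split=> // v; rewrite inE => /predU1P[->|/fp].
have [g [gi gw gfix]] := isometry_reflection fw.
exists (g \o f); split=> [a b|v] /=; first by rewrite gi fi.
rewrite inE => /predU1P[->//|vs]; rewrite -fp // gfix // {1 2}fp //.
by rewrite ((isometry_dot f).1 fi); exact: h.
Qed.

Lemma le_term_sum (I : finType) (F : I -> R) i :
  (forall j, 0 <= F j) -> F i <= \sum_j F j.
Proof. by move=> h; rewrite (bigD1 i) //= lerDl sumr_ge0. Qed.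

Lemma dot_diff_bound (w w' : point d) (s t : R) : 0 <= s ->
  (forall i, `|w' ord0 i - w ord0 i| <= s) ->
  (forall i, `|w' ord0 i + w ord0 i| <= t) ->
  `|dot w' w' - dot w w| <= d%:R * (s * t).
Proof.
move=> s0 hs ht.
have -> : dot w' w' - dot w w =
    \sum_(i < d) (w' ord0 i - w ord0 i) * (w' ord0 i + w ord0 i).
  by rewrite -sumrB; apply: eq_bigr => i _; ring.
apply: le_trans (ler_norm_sum _ _ _) _.
apply: le_trans (_ : \sum_(i < d) s * t <= _); last first.
  by rewrite sumr_const card_ord mulr_natl.
by apply: ler_sum => i _; rewrite normrM ler_pM.
Qed.

Lemma sqdist_continuous p (e : R) : 0 < e -> exists2 t, 0 < t &
  forall q, (forall v i, `|q v ord0 i - p v ord0 i| < t) ->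
  forall u v, `|sqdist q u v - sqdist p u v| < e.
Proof.
move=> e0.
pose M : R := \sum_(x : V * V * 'I_d) `|p x.1.1 ord0 x.2 - p x.1.2 ord0 x.2|.
have M0 : 0 <= M by apply: sumr_ge0 => i _.
have d0 : 0 <= d%:R :> R by rewrite ler0n.
set A : R := d%:R * (4 * (1 + M)).
have A0 : 0 <= A by rewrite /A !mulr_ge0 ?addr_ge0.
have eA : 0 < e + A by lra.
(* This gives [t <= 1] and [t * A < e], where [t * A] bounds [d * (2t) * (2t + 2M)] once
   [t <= 1]. *)
pose t := e / (1 + e + A).
have t0 : 0 < t by rewrite divr_gt0 //; lra.
have t1 : t <= 1 by rewrite ler_pdivrMr; lra.
have tA : t * A < e.
  by rewrite /t mulrAC ltr_pdivrMr; [rewrite ltr_pM2l; lra | lra].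
exists t => // q hq u v; apply: le_lt_trans tA.
have hM i : `|p u ord0 i - p v ord0 i| <= M.
  apply: (@le_term_sum _
    (fun x : V * V * 'I_d => `|p x.1.1 ord0 x.2 - p x.1.2 ord0 x.2|) (u, v, i)).
  by move=> x; exact: normr_ge0.
apply: le_trans (dot_diff_bound (s := 2 * t) (t := 2 * t + 2 * M) _ _ _) _.
- by lra.
- move=> i; rewrite !mxE; have := ltW (hq u i); have := ltW (hq v i).
  by rewrite !ler_norml => /andP[? ?] /andP[? ?]; apply/andP; split; lra.
- move=> i; rewrite !mxE; have := ltW (hq u i); have := ltW (hq v i); have := hM i.
  by rewrite !ler_norml => /andP[? ?] /andP[? ?] /andP[? ?]; apply/andP; split; lra.
rewrite /A [in leRHS]mulrCA ler_wpM2l //.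
have -> : t * (4 * (1 + M)) = 2 * t * (2 * 1 + 2 * M) by ring.
by rewrite ler_wpM2l //; lra.
Qed.

Lemma enorm_small (e : R) : 0 < e -> exists2 t, 0 < t &
  forall a : point d, (forall i, `|a ord0 i| < t) -> enorm a < e.
Proof.
move=> e0; have d0 : 0 <= d%:R :> R by rewrite ler0n.
pose t := e / (1 + d%:R).
have t0 : 0 < t by rewrite divr_gt0 //; lra.
exists t => // a ha; rewrite enormE -[ltRHS](gtr0_norm e0) -sqrtr_sqr ltr_sqrt ?exprn_gt0 //.
have h : dot a a <= d%:R * (t * t).
  rewrite mulr_natl -[in leRHS](card_ord d) -sumr_const; apply: ler_sum => i _.
  apply: le_trans (ler_norm _) _; rewrite normrM; apply: ler_pM => //; exact/ltW/ha.
apply: le_lt_trans h _.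
have -> : e = t * (1 + d%:R) by rewrite /t mulfVK //; lra.
by have := mulr_gt0 t0 t0; nra.
Qed.

End Realisations.

(** * Local surjectivity of the edge lengths *)

Section LocalSurjectivity.
Variables (V : finType) (d : nat) (adj : rel V).
Hypothesis adj_sym : ssrbool.symmetric adj.
Implicit Types (p q h : realisation V d).

(* Surjectivity of the rigidity matrix at [q], i.e. the edges are independent. *)
Definition edge_independent q : Prop :=
  forall c : V -> V -> R, (forall u v, c u v = c v u) ->
  exists h : realisation V d,
    forall u v, adj u v -> dot (q u - q v) (h u - h v) = c u v.

(** Half weight on each order of the pair gives the symmetric target that [edge_independent] asks
    for; for symmetric [z] the two halves add up to [z (u, v)]. *)
Definition edge_indicator (x : V * V) u v : R :=
  (((u, v) == x)%:R + ((v, u) == x)%:R) / 2.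

(** A linear right inverse of the rigidity matrix when each [H x] realises [edge_indicator x]. *)
Definition velocity_comb (H : V * V -> realisation V d) (z : V * V -> R) :
  realisation V d := fun v => \sum_x z x *: H x v.

Lemma velocity_combE q H z u v :
  (forall x u v, adj u v -> dot (q u - q v) (H x u - H x v) = edge_indicator x u v) ->
  (forall u v, z (u, v) = z (v, u)) -> adj u v ->
  dot (q u - q v) (velocity_comb H z u - velocity_comb H z v) = z (u, v).
Proof.
move=> hH zsym uv; rewrite /velocity_comb -sumrB dot_sumr.
under eq_bigr => x _ do rewrite -scalerBr dotZr (hH x u v uv) /edge_indicator mulrA mulrDr.
rewrite -mulr_suml big_split /=.
have pick w : \sum_x z x * (w == x)%:R = z w.
  rewrite (bigD1 w) //= eqxx mulr1 big1 ?addr0 // => x.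
  by rewrite eq_sym => /negbTE ->; rewrite mulr0.
by rewrite !pick -(zsym u v); lra.
Qed.

(** With [B] a right inverse of the rigidity matrix, the squared lengths at [q + B z] are those at
    [q] plus [2 z + N z] with [N] quadratic. Solving for the increment [c] is the fixed point
    equation [z = (c - N z) / 2], a contraction near [0]. *)
Lemma edge_local_surjectivity q : edge_independent q ->
  forall e : R, 0 < e -> exists2 t : R, 0 < t &
  forall y : V -> V -> R, (forall u v, y u v = y v u) ->
    (forall u v, adj u v -> `|y u v - sqdist q u v| < t) ->
  exists2 q' : realisation V d, (forall v i, `|q' v ord0 i - q v ord0 i| < e) &
    forall u v, adj u v -> sqdist q' u v = y u v.
Proof.
move=> indep e e0.
have [x|H hH] := choice (P := fun (x : V * V) h => forall u v, adj u v ->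
    dot (q u - q v) (h u - h v) = edge_indicator x u v).
  by apply: indep => u v; rewrite /edge_indicator addrC.
pose B := velocity_comb H.
have Bq z u v : (forall u v, z (u, v) = z (v, u)) -> adj u v ->
    dot (q u - q v) (B z u - B z v) = z (u, v) by exact: velocity_combE.
pose M : R := \sum_(x : V * V * V * 'I_d) `|H x.1.1 x.1.2 ord0 x.2|.
have M0 : 0 <= M by apply: sumr_ge0 => i _.
have BM z t : 0 <= t -> (forall x, `|z x| <= t) -> forall v i, `|B z v ord0 i| <= M * t.
  move=> t0 zt v i; rewrite /B /velocity_comb summxE; apply: le_trans (ler_norm_sum _ _ _) _.
  apply: le_trans (_ : \sum_x `|H x v ord0 i| * t <= _).
    by apply: ler_sum => x _; rewrite mxE normrM mulrC ler_wpM2l.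
  rewrite -mulr_suml ler_wpM2r // /M.
  rewrite -(pair_bigA _ (fun x i => `|H x.1 x.2 ord0 i|)) /=.
  rewrite -(pair_bigA _ (fun x v => \sum_(i < d) `|H x v ord0 i|)) /=.
  apply: ler_sum => x _; apply: le_trans (le_term_sum v _) => [|w].
    by apply: (le_term_sum i) => j.
  by apply: sumr_ge0.
have d0 : 0 <= d%:R :> R by rewrite ler0n.
pose D := d%:R * (M * M).
have D0 : 0 <= D by rewrite mulr_ge0 ?mulr_ge0.
(* The summands of [A] make the radius [r] positive, give [N] Lipschitz constant at most [1] on the
   cube, and keep the displacement below [e]. *)
pose A := 1 + 8 * D + (M + 1) / e.
have Me : 0 < (M + 1) / e by rewrite divr_gt0 //; lra.
have A0 : 0 < A by rewrite /A; lra.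
pose r := A^-1.
have r0 : 0 < r by rewrite invr_gt0.
have rD : 8 * D * r <= 1 by rewrite ler_pdivrMr // /A; lra.
have rM : M * r < e.
  rewrite ltr_pdivrMr //.
  have -> : e * A = e + e * (8 * D) + (M + 1) by rewrite /A; field; rewrite gt_eqF.
  have : 0 <= e * (8 * D) by rewrite !mulr_ge0 // ltW.
  by move=> ?; lra.
exists r => // y ysym yq.
pose c u v := if adj u v then y u v - sqdist q u v else 0.
have csym u v : c u v = c v u by rewrite /c adj_sym ysym sqdistC.
have cr u v : `|c u v| <= r.
  by rewrite /c; case: ifP => [/yq/ltW //|_]; rewrite normr0 ltW.
pose N z (x : V * V) := dot (B z x.1 - B z x.2) (B z x.1 - B z x.2).
pose T z x := (c x.1 x.2 - N z x) / 2.
have NN z z' t : (forall x, `|z x| <= r) -> (forall x, `|z' x| <= r) ->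
    (forall x, `|z x - z' x| <= t) -> forall x, `|N z x - N z' x| <= 8 * D * r * t.
  move=> zr z'r zz' x.
  have t0 : 0 <= t by apply: le_trans (zz' x).
  have BB v i : `|B z v ord0 i - B z' v ord0 i| <= M * t.
    have -> : B z v ord0 i - B z' v ord0 i = B (fun x => z x - z' x) v ord0 i.
      rewrite /B /velocity_comb !summxE -sumrB; apply: eq_bigr => j _.
      by rewrite !mxE mulrBl.
    exact: BM.
  have Br := BM z r (ltW r0) zr; have B'r := BM z' r (ltW r0) z'r.
  apply: le_trans (dot_diff_bound (s := 2 * (M * t)) (t := 4 * (M * r)) _ _ _) _.
  - by rewrite !mulr_ge0.
  - move=> i; rewrite !mxE.
    have := BB x.1 i; have := BB x.2 i.
    by rewrite !ler_norml => /andP[? ?] /andP[? ?]; apply/andP; split; lra.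
  - move=> i; rewrite !mxE.
    have := Br x.1 i; have := Br x.2 i; have := B'r x.1 i; have := B'r x.2 i.
    rewrite !ler_norml => /andP[? ?] /andP[? ?] /andP[? ?] /andP[? ?].
    by apply/andP; split; lra.
  by rewrite /D le_eqVlt; apply/orP; left; apply/eqP; ring.
pose z0 (x : V * V) : R := 0.
have N0 x : N z0 x = 0.
  rewrite /N /B /velocity_comb /z0; apply: big1 => i _.
  by rewrite !mxE !summxE !big1 ?subrr ?mulr0 // => j _; rewrite mxE mul0r.
have [|z z' t zr z'r|z zr Tz] := contraction_fixpoint (T := T) (ltW r0).
- move=> z zr x.
  have h : `|N z x| <= r.
    rewrite -[N z x]subr0 -(N0 x).
    apply: le_trans (NN z z0 r zr _ _ x) _ => [j|j|].
    - by rewrite /z0 normr0 ltW.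
    - by rewrite /z0 subr0.
    - by rewrite ler_piMl // ltW.
  have := cr x.1 x.2; rewrite /T; move: h.
  by rewrite !ler_norml => /andP[? ?] /andP[? ?]; apply/andP; split; lra.
- move=> zz' x; have := NN z z' t zr z'r zz' x.
  have t0 : 0 <= t by apply: le_trans (zz' x).
  have : 8 * D * r * t <= t by rewrite ler_piMl.
  rewrite /T !ler_norml => ? /andP[? ?]; apply/andP; split; lra.
(* The fixed point is symmetric because [c] and [N z] are. *)
have zsym u v : z (u, v) = z (v, u).
  rewrite -!Tz /T /= csym; congr ((_ - _) / 2).
  by rewrite /N /= !dotE (dotC (B z v) (B z u)); ring.
exists (fun v => q v + B z v) => [v i|u v uv].
  rewrite mxE [X in `|X|](_ : _ = B z v ord0 i); last by ring.
  apply: le_lt_trans rM; exact: (BM z r (ltW r0)).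
have h1 := Bq z u v zsym uv.
have h2 : c u v - N z (u, v) = 2 * z (u, v) by rewrite -[in RHS]Tz /T /=; lra.
have -> : y u v = sqdist q u v + c u v by rewrite /c uv; ring.
have -> : c u v = 2 * z (u, v) + N z (u, v) by lra.
rewrite -h1 /sqdist /N /=.
have -> : q u + B z u - (q v + B z v) = (q u - q v) + (B z u - B z v).
  by rewrite opprD addrACA.
move: (q u - q v) (B z u - B z v) => a b.
by rewrite !dotE (dotC b a); ring.
Qed.

End LocalSurjectivity.

(** * Lengths as polynomials in the coordinates *)

Section Evaluation.
Variables (V : finType) (d : nat).
Implicit Types (p q : realisation V d) (adj : rel V).

Local Notation coordring := {mpoly rat[#|{: V * 'I_d}|]}.

Definition evalp p : coordring -> R :=
  meval (coords p) \o map_mpoly (ratr : rat -> R).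

HB.instance Definition _ p := GRing.RMorphism.copy (evalp p)
  (meval (coords p) \o map_mpoly (ratr : rat -> R)).

Lemma generic_eq0 p f : generic p -> evalp p f = 0 -> f = 0.
Proof.
rewrite /evalp /= => gp f0; have [//|/gp] := eqVneq f 0.
by rewrite f0 eqxx.
Qed.

Definition coordX v i : coordring := 'X_(enum_rank (v, i)).

Lemma evalp_coordX p v i : evalp p (coordX v i) = p v ord0 i.
Proof.
rewrite /evalp /= /coordX map_mpolyX mevalXU /coords enum_rankK //.
Qed.

Definition sqdistX u v : coordring :=
  \sum_(i < d) (coordX u i - coordX v i) * (coordX u i - coordX v i).

Lemma evalp_sqdistX p u v : evalp p (sqdistX u v) = sqdist p u v.
Proof.
rewrite rmorph_sum /=; apply: eq_bigr => i _.
by rewrite rmorphM rmorphB /= !evalp_coordX !mxE.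
Qed.

Lemma horner_evalp p (P : {poly coordring}) g :
  (map_poly (evalp p) P).[evalp p g] = evalp p P.[g].
Proof. exact: horner_map. Qed.

(* Stands in for the subring generated by the squared edge lengths. *)
Definition length_invariant adj (f : coordring) : Prop :=
  forall q q', (forall u v, adj u v -> sqdist q u v = sqdist q' u v) ->
  evalp q f = evalp q' f.

Definition length_transcendental adj (g : coordring) : Prop :=
  forall P : {poly coordring}, (forall k, length_invariant adj P`_k) ->
  P.[g] = 0 -> P = 0.

Lemma length_invariant_sqdistX adj u v :
  adj u v -> length_invariant adj (sqdistX u v).
Proof. by move=> uv q q' h; rewrite !evalp_sqdistX h. Qed.

Lemma length_invariant_map_poly adj (P : {poly coordring}) q q' :
  (forall k, length_invariant adj P`_k) ->
  (forall u v, adj u v -> sqdist q u v = sqdist q' u v) ->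
  map_poly (evalp q) P = map_poly (evalp q') P.
Proof. by move=> hP h; apply/polyP => k; rewrite !coef_map /= (hP k _ _ h). Qed.

(** A relation for [g] at [q] has coefficients that take the same values at [p], so it holds at [p],
    and by genericity it is an identity of polynomials. Hence [evalp q g] is transcendental over the
    values of invariants at [q]. *)
Lemma transcendental_derivation adj g p q : generic p ->
  (forall u v, adj u v -> sqdist p u v = sqdist q u v) ->
  evalp p g = evalp q g -> length_transcendental adj g ->
  exists D, [/\ derivation D,
    forall f, length_invariant adj f -> D (evalp q f) = 0 & D (evalp q g) = 1].
Proof.
move=> gp pq gpq trg.
have [|_ _ [f hf ->] [f' hf' ->]|_ _ [f hf ->] [f' hf' ->]|P hP Pg|D [hD DS Dg]] :=
  @derivation_transcendental R
    (fun a => exists2 f, length_invariant adj f & a = evalp q f) (evalp q g).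
- by exists 1; [move=> ? ? _; rewrite !rmorph1 | rewrite rmorph1].
- exists (f - f'); last by rewrite rmorphB.
  by move=> q1 q2 h; rewrite !rmorphB /= (hf _ _ h) (hf' _ _ h).
- exists (f * f'); last by rewrite rmorphM.
  by move=> q1 q2 h; rewrite !rmorphM /= (hf _ _ h) (hf' _ _ h).
- have [|f hf] := choice (P := fun k f => length_invariant adj f /\ P`_k = evalp q f).
    by move=> k; have [f] := hP k; exists f.
  pose F := \poly_(k < size P) f k.
  have Finv k : length_invariant adj F`_k.
    rewrite coef_poly; case: ifP => _; first by case: (hf k).
    by move=> ? ? _; rewrite !rmorph0.
  have FP : map_poly (evalp q) F = P.
    apply/polyP => k; rewrite coef_map /= coef_poly; case: ltnP => hk.
      by rewrite -(hf k).2.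
    by rewrite rmorph0 nth_default.
  suff F0 : F = 0 by rewrite -FP F0 rmorph0.
  apply: trg => //; apply: (generic_eq0 gp).
  by rewrite -horner_evalp gpq (length_invariant_map_poly Finv pq) FP.
- by exists D; split=> // f hf; apply: DS; exists f.
Qed.

(** By the Leibniz rule, [D] of a squared length is its rate of change along this velocity. *)
Definition derived_velocity (D : R -> R) q : realisation V d :=
  fun v => \row_i D (q v ord0 i).

Lemma derivation_sqdist D q u v : derivation D ->
  D (sqdist q u v) =
  2 * dot (q u - q v) (derived_velocity D q u - derived_velocity D q v).
Proof.
move=> hD; rewrite (derivation_sum hD) mulr_sumr; apply: eq_bigr => i _.
by rewrite (derivationM hD) !mxE (derivationB hD); ring.
Qed.

End Evaluation.

(** * Consequences of minimal rigidity *)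

Lemma isolated_in_seq (s : seq R) (l : R) : exists2 e, 0 < e &
  forall t, t \in s -> `|t - l| < e -> t = l.
Proof.
elim: s => [|a s [e e0 he]]; first by exists 1.
have [->|al] := eqVneq a l.
  by exists e => // t; rewrite inE => /predU1P[-> //|]; exact: he.
have al0 : 0 < `|a - l| by rewrite normr_gt0 subr_eq0.
exists (Num.min e `|a - l|) => [|t]; first by rewrite lt_min e0.
rewrite inE lt_min => /predU1P[->|/he ht] /andP[// h1 h2]; last exact: ht.
by rewrite ltxx in h2.
Qed.

Section Rigidity.
Variables (V : finType) (d : nat) (adj : rel V).
Implicit Types (p q : realisation V d).

Lemma del_edge_cases a b u v : adj u v ->
  [\/ del_edge adj a b u v, u = a /\ v = b | u = b /\ v = a].
Proof.
rewrite /del_edge => ->; case: (boolP (_ || _)) => [|_]; last by constructor 1.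
by case/orP => /andP[/eqP-> /eqP->]; [constructor 2|constructor 3].
Qed.

(* Otherwise the length of [ab] would be confined to a finite set by the
   other lengths, so that removing [ab] would preserve rigidity. *)
Lemma edge_length_transcendental p a b : generic p -> rigid_framework adj p ->
  ~ d_rigid (del_edge adj a b) d ->
  length_transcendental (del_edge adj a b) (sqdistX d a b).
Proof.
move=> gp [e [e0 rig]] ndel P Pinv Pab.
have [//|P0] := eqVneq P 0; case: ndel; exists p; split=> //.
have Pp0 : map_poly (evalp p) P != 0.
  apply: contraNneq P0 => Pp; apply/eqP/polyP => k; rewrite coef0.
  apply: (generic_eq0 gp).
  by have := congr1 (fun Q : {poly R} => Q`_k) Pp; rewrite coef_map coef0.
have [s hs] := finite_roots (f := id) Pp0 (@inj_id _).
have [r r0 hr] := isolated_in_seq s (sqdist p a b).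
have [t t0 ht] := sqdist_continuous p r0.
exists (Num.min e t); split=> [|q pq pqnear]; first by rewrite lt_min e0.
have {}pq := (equivalent_sqdist _ _ _).1 pq.
apply: rig => [|v]; last by have := pqnear v; rewrite lt_min => /andP[].
(* The squared length of [ab] at [q] is a root of the same polynomial as at [p], and continuity
   brings it too close to be a different root. *)
have qab : sqdist q a b = sqdist p a b.
  apply: hr.
    apply: hs; rewrite (length_invariant_map_poly Pinv pq) -evalp_sqdistX.
    by apply/rootP; rewrite horner_evalp Pab rmorph0.
  apply: ht => v i; apply: le_lt_trans (_ : enorm (q v - p v) < _).
    by have := coord_le_enorm (q v - p v) i; rewrite !mxE.
  by have := pqnear v; rewrite lt_min => /andP[].
apply/equivalent_sqdist => u v /(@del_edge_cases a b)[/pq //|[-> ->]|[-> ->]].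
  by rewrite qab.
by rewrite sqdistC -qab sqdistC.
Qed.

Hypothesis simple : simple_graph adj.

Lemma equivalent_edge_independent p q : generic p -> equivalent adj p q ->
  (forall a b, adj a b ->
     length_transcendental (del_edge adj a b) (sqdistX d a b)) ->
  edge_independent adj q.
Proof.
case: simple => sym irr gp /equivalent_sqdist pq tr.
have [x|H hH] := choice (P := fun (x : V * V) h => forall u v, adj u v ->
    dot (q u - q v) (h u - h v) = edge_indicator x u v).
  case: x => a b; have [ab|nab] := boolP (adj a b); last first.
    (* For a non-edge the indicator vanishes on all edges. *)
    exists (fun=> 0) => u v uv; rewrite subrr dot0r /edge_indicator.
    have -> : (u, v) == (a, b) = false by apply: contraNF nab => /eqP[<- <-].
    have -> : (v, u) == (a, b) = false.
      by apply: contraNF nab => /eqP[<- <-]; rewrite sym.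
    by rewrite addr0 mul0r.
  have [u v /andP[uv _]||D [hD D0 D1]] :=
    transcendental_derivation (q := q) gp _ _ (tr _ _ ab).
  - exact: pq.
  - by rewrite !evalp_sqdistX pq.
  exists (derived_velocity D q) => u v uv.
  have ba : (b == a) = false by apply: contraTF ab => /eqP->; rewrite irr.
  rewrite evalp_sqdistX in D1.
  have Dsq := derivation_sqdist q u v hD.
  suff : D (sqdist q u v) = 2 * edge_indicator (a, b) u v by rewrite Dsq => ?; lra.
  rewrite /edge_indicator !xpair_eqE.
  case: (del_edge_cases a b uv) => [duv|[-> ->]|[-> ->]].
  - rewrite -evalp_sqdistX D0; last exact: length_invariant_sqdistX.
    move: duv; rewrite /del_edge uv /= negb_or.
    by case/andP => /negbTE-> /negbTE; rewrite andbC => ->; rewrite addr0 mul0r mulr0.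
  - by rewrite D1 !eqxx ba /= addr0 mul1r mulfV // pnatr_eq0.
  - by rewrite sqdistC D1 !eqxx ba /= add0r mul1r mulfV // pnatr_eq0.
move=> c csym; exists (velocity_comb H (fun x => c x.1 x.2)) => u v uv.
exact: (velocity_combE hH).
Qed.

(** If a flex [h] changed the length of [ab], the edges together with [ab] would be independent, and
    the length of [ab] alone could be altered arbitrarily near [p], against rigidity. *)
Lemma rigid_infinitesimally p : rigid_framework adj p -> edge_independent adj p ->
  forall h, (forall u v, adj u v -> dot (p u - p v) (h u - h v) = 0) ->
  forall a b, dot (p a - p b) (h a - h b) = 0.
Proof.
case: simple => sym irr [e [e0 rig]] indep h hh a b.
have [//|k0] := eqVneq (dot (p a - p b) (h a - h b)) 0.
pose new u v := ((u == a) && (v == b)) || ((u == b) && (v == a)).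
pose adj2 u v := adj u v || new u v.
have newC u v : new u v = new v u.
  by rewrite /new orbC [(v == _) && _]andbC [(u == b) && _]andbC [(v == b) && _]andbC.
have sym2 : ssrbool.symmetric adj2 by move=> u v; rewrite /adj2 sym newC.
have hC u v : dot (p u - p v) (h u - h v) = dot (p v - p u) (h v - h u).
  by rewrite -(opprB (p v)) -(opprB (h v)) !dotE; ring.
have indep2 : edge_independent adj2 p.
  move=> c csym; have [h1 hh1] := indep c csym.
  (* Adding [m *: h] corrects the rate on [ab] and leaves those on the edges unchanged. *)
  pose m := (c a b - dot (p a - p b) (h1 a - h1 b)) / dot (p a - p b) (h a - h b).
  exists (fun v => h1 v + m *: h v) => u v uv.
  have -> : h1 u + m *: h u - (h1 v + m *: h v) = (h1 u - h1 v) + m *: (h u - h v).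
    by apply/rowP => i; rewrite !mxE; ring.
  rewrite dotDr dotZr.
  case/orP: uv => [uv|]; first by rewrite hh1 // hh // mulr0 addr0.
  case/orP => /andP[/eqP-> /eqP->]; first by rewrite /m; field; exact: k0.
  rewrite (hC b a) csym.
  have -> : dot (p b - p a) (h1 b - h1 a) = dot (p a - p b) (h1 a - h1 b).
    by rewrite -(opprB (p a)) -(opprB (h1 a)) dotNl dotNr opprK.
  by rewrite /m; field; exact: k0.
have [t t0 ht] := enorm_small d e0.
have [r r0 hr] := edge_local_surjectivity sym2 indep2 t0.
have [||q hq1 hq2] := hr (fun u v => sqdist p u v + (if adj u v then 0 else r / 2)).
- by move=> u v; rewrite sqdistC sym.
- move=> u v _; rewrite addrAC subrr add0r.
  by case: ifP => _; rewrite ?normr0 // gtr0_norm; lra.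
have /congruent_sqdist/(_ a b) pqab : congruent p q.
  apply: rig => [|v]; last by apply: ht => i; rewrite !mxE; exact: hq1.
  apply/equivalent_sqdist => u v uv.
  by rewrite hq2 ?uv ?addr0 // /adj2 uv.
have : adj a b = false by apply: contraNF k0 => /hh ->.
have := hq2 a b; rewrite /adj2 /new !eqxx orbT -pqab => /(_ isT) /[swap] -> h2.
by move: r0; lra.
Qed.

End Rigidity.

(** * The spider split *)

Section Star.
Variables (V : finType) (d : nat) (adj : rel V) (x : V) (w : 'I_d -> V).
Implicit Types (p q h : realisation V d).

(* Twice the Gram matrix of the vectors [x - w j], in terms of lengths. *)
Definition star_gram : 'M[{mpoly rat[#|{: V * 'I_d}|]}]_d :=
  \matrix_(j, k) (sqdistX d x (w j) + sqdistX d x (w k) - sqdistX d (w j) (w k)).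

Definition star_det := \det star_gram.

Lemma evalp_star_det q : evalp q star_det =
  \det (\matrix_(j, k) (sqdist q x (w j) + sqdist q x (w k) - sqdist q (w j) (w k))).
Proof.
rewrite -det_map_mx; congr (\det _); apply/matrixP => j k; rewrite !mxE.
by rewrite rmorphB rmorphD /= !evalp_sqdistX.
Qed.

Definition star_mx q : 'M[R]_d := \matrix_(j, i) (q x - q (w j)) ord0 i.

Lemma evalp_star_detE q : evalp q star_det = \det (star_mx q *m (2 *: (star_mx q)^T)).
Proof.
rewrite evalp_star_det; congr (\det _); apply/matrixP => j k; rewrite !mxE.
have -> : sqdist q (w j) (w k) = sqdist q x (w j) + sqdist q x (w k)
    - 2 * dot (q x - q (w j)) (q x - q (w k)).
  rewrite /sqdist !dotE (dotC (q (w j)) (q x)) (dotC (q (w k)) (q x)).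
  by rewrite (dotC (q (w k)) (q (w j))); ring.
rewrite opprB addrC subrK mulr_sumr; apply: eq_bigr => i _; rewrite !mxE; ring.
Qed.

Lemma star_solve q : evalp q star_det != 0 ->
  forall c : 'I_d -> R, exists y, forall j, dot (q x - q (w j)) y = c j.
Proof.
rewrite evalp_star_detE det_mulmx mulf_eq0 negb_or => /andP[dA _] c.
pose A := star_mx q; have uA : A \in unitmx by rewrite unitmxE unitfE.
exists (invmx A *m \col_j c j)^T => j.
have := congr1 (fun M : 'cV_d => M j ord0) (mulKVmx uA (\col_j c j)).
rewrite mxE [in RHS]mxE => <-; apply: eq_bigr => i _.
by rewrite [A j i]mxE [(_)^T _ _]mxE.
Qed.

Hypotheses (w_inj : injective w) (w_x : forall j, w j != x).

Lemma star_det_neq0 : star_det != 0.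
Proof.
(* With [x] at the origin and [w i] at minus the [i]-th unit vector, [star_mx] is the identity. *)
pose p0 : realisation V d := fun v => \row_i (if v == w i then -1 else 0).
apply/eqP => /(congr1 (evalp p0)); rewrite rmorph0 evalp_star_detE.
have -> : star_mx p0 = 1%:M.
  apply/matrixP => j i; rewrite !mxE eq_sym (negbTE (w_x i)) sub0r (inj_eq w_inj).
  by case: (j == i); rewrite ?opprK ?oppr0.
rewrite mul1mx trmx1 scalemx1 det_scalar => /eqP.
by rewrite expf_eq0 pnatr_eq0 andbF.
Qed.

Lemma star_det_nonvanishing p q : simple_graph adj -> minimally_d_rigid adj d ->
  generic p -> equivalent adj p q -> evalp q star_det != 0.
Proof.
move=> simple [[p0 [gp0 rig0]] min] gp pq.
have trE a b : adj a b -> length_transcendental (del_edge adj a b) (sqdistX d a b).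
  by move=> ab; apply: edge_length_transcendental gp0 rig0 _; exact: min.
have ind0 : edge_independent adj p0.
  by apply: (equivalent_edge_independent simple gp0 _ trE) => u v.
have inf0 := rigid_infinitesimally simple rig0 ind0.
(* A derivation killing the edge lengths yields an infinitesimal flex of [p0], hence kills all
   squared distances and the determinant, so it cannot send the latter to [1]. *)
have ntr : ~ length_transcendental adj star_det.
  move=> tr; have [//|//|D [hD D0 D1]] := transcendental_derivation (q := p0) gp0 _ _ tr.
  have Dsq u v : D (sqdist p0 u v) = 0.
    rewrite derivation_sqdist // inf0 ?mulr0 // => {}u {}v uv.
    have := derivation_sqdist p0 u v hD.
    rewrite -evalp_sqdistX D0; last exact: length_invariant_sqdistX.
    by move=> ?; lra.
  move: D1; rewrite evalp_star_det derivation_det0 // => [/eqP|j k].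
    by rewrite eq_sym oner_eq0.
  by rewrite mxE (derivationB hD) (derivationD hD) !Dsq subr0 addr0.
(* Failure of transcendence gives a nonzero relation; dividing by powers of ['X], allowed since
   [star_det] is nonzero, makes its constant term nonzero. *)
have [P [Pinv Pg P00]] : exists P : {poly {mpoly rat[#|{: V * 'I_d}|]}},
    [/\ forall k, length_invariant adj P`_k, P.[star_det] = 0 & P`_0 != 0].
  apply: contrapT => nP; apply: ntr => P.
  elim/ltn_ind: {P}(size P) {-2}P (erefl (size P)) => n IH P sP Pinv Pg.
  have [P0|P0] := eqVneq P`_0 0; last by case: nP; exists P.
  have [Q PQ] : exists Q, P = Q * 'X.
    have /factor_theorem[Q] : root P 0 by rewrite /root horner_coef0 P0.
    by rewrite subr0 => ->; exists Q.
  have [Q0|Q0] := eqVneq Q 0; first by rewrite PQ Q0 mul0r.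
  rewrite PQ (IH (size Q) _ Q) ?mul0r //.
  - by rewrite -sP PQ size_mulX.
  - by move=> k; have := Pinv k.+1; rewrite PQ coefMX.
  - move/eqP: Pg; rewrite PQ hornerM hornerX mulf_eq0 (negbTE star_det_neq0) orbF.
    by move/eqP.
have pq' := (equivalent_sqdist _ _ _).1 pq.
apply: contraNneq P00 => g0; apply/eqP/(generic_eq0 gp).
rewrite (Pinv 0%N _ _ pq').
have := congr1 (evalp q) Pg; rewrite -horner_evalp g0 horner_coef0 coef_map /=.
by rewrite rmorph0.
Qed.

End Star.

(** * Independence at the doubled realisation *)

Definition double_point (V : finType) (d : nat) (x : V) (q : realisation V d) :
  realisation (option V) d := fun a => q (odflt x a).

Section SpiderSplit.
Variables (V : finType) (d : nat) (adj : rel V) (x : V) (N1 N2 W : {set V}).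
Hypotheses (simple : simple_graph adj)
  (part : spider_partition adj d x N1 N2 W).
Implicit Types (p q h : realisation V d).

Local Notation adj' := (spider_split adj x N1 N2 W).

Lemma spider_split_sym : ssrbool.symmetric adj'.
Proof.
have [sym _] := simple; case=> [u|] [v|] //=.
by case: (eqVneq u x) => [->|_]; case: (v == x) => //=; exact: sym.
Qed.

Lemma spider_part_adj v : (v \in N1 :|: W) || (v \in N2 :|: W) -> adj x v.
Proof.
move=> h; have [e _ _ _ _] := part.
have : v \in nbhd adj x by rewrite -e; move: h; rewrite !inE; do 3!case: (v \in _).
by rewrite inE.
Qed.

Lemma spider_split_adj a b : adj' a b -> adj (odflt x a) (odflt x b).
Proof.
have [sym _] := simple.
have N1W v : v \in N1 :|: W -> adj x v by move=> h; apply: spider_part_adj; rewrite h.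
have N2W v : v \in N2 :|: W -> adj x v.
  by move=> h; apply: spider_part_adj; rewrite h orbT.
case: a b => [u|] [v|] //=; last 2 first.
- by rewrite sym => /andP[_ /N2W].
- by case/andP => _ /N2W.
case: eqVneq => [->|_]; first by case/andP => _ /N1W.
by case: eqVneq => [-> /N1W|//]; rewrite sym.
Qed.

Lemma double_point_equivalent p q : equivalent adj p q ->
  forall a b, adj' a b ->
  sqdist (double_point x p) a b = sqdist (double_point x q) a b.
Proof. by move/equivalent_sqdist => pq a b /spider_split_adj /pq. Qed.

(* The difference [y] of the velocities of the two copies of [x] is determined
   by the [d] common neighbours; the rest is a system on the original graph. *)
Lemma spider_split_independent q : edge_independent adj q ->
  (forall c : V -> R, exists y, forall v, v \in W -> dot (q x - q v) y = c v) ->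
  edge_independent adj' (double_point x q).
Proof.
have [sym irr] := simple; have [_ N12 N1W N2W _] := part.
move=> ind solve c csym.
have [y hy] := solve (fun v => c None (Some v) - c (Some x) (Some v)).
(* The second copy moves with velocity [h x + y], so on [N2] the contribution of [y] is subtracted
   in advance. *)
pose cx v := if v \in N2 then c None (Some v) - dot (q x - q v) y
             else c (Some x) (Some v).
pose c0 u v := if u == x then cx v else if v == x then cx u else c (Some u) (Some v).
have [u v|h hh] := ind c0.
  rewrite /c0; case: (eqVneq u x) => [->|_]; last by case: (v == x).
  by case: eqVneq => [->|_].
have hx v : adj x v -> dot (q x - q v) (h x - h v) = cx v.
  by move=> xv; rewrite hh // /c0 eqxx.
have N1Wx v : v \in N1 :|: W ->
    dot (q x - q v) (h x - h v) = c (Some x) (Some v).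
  move=> vN; rewrite hx; last by apply: spider_part_adj; rewrite vN.
  rewrite /cx ifF //; apply/negbTE; case/setUP: vN => vN.
    by rewrite (disjointFr N12).
  by rewrite (disjointFl N2W).
have N2Wx v : v \in N2 :|: W ->
    dot (q x - q v) (h x + y - h v) = c None (Some v).
  move=> vN; rewrite addrAC dotDr hx; last by apply: spider_part_adj; rewrite vN orbT.
  rewrite /cx; case: ifP => vN2; first by rewrite subrK.
  by move: vN; rewrite inE vN2 => /hy ->; rewrite addrC subrK.
have flip (a b a' b' : point d) : dot (a - b) (a' - b') = dot (b - a) (b' - a').
  by rewrite -(opprB b) -(opprB b') dotNl dotNr opprK.
exists (fun a => if a is Some v then h v else h x + y) => -[u|] [v|] //=;
  rewrite /double_point /=.
- case: eqVneq => [->|ux]; first by case/andP => _ /N1Wx.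
  case: eqVneq => [-> uN|vx uv]; first by rewrite flip N1Wx // csym.
  by rewrite hh // /c0 (negbTE ux) (negbTE vx).
- by case/andP => _ uN; rewrite flip N2Wx // csym.
- by case/andP => _ /N2Wx.
Qed.

End SpiderSplit.

(** * Perturbing the doubled realisations *)

Lemma common_radius (I : finType) (P : I -> R -> Prop) :
  (forall i s t, s <= t -> P i t -> P i s) ->
  (forall i, exists2 t, 0 < t & P i t) -> exists2 t, 0 < t & forall i, P i t.
Proof.
move=> Pmono Pex.
suff [t t0 ht] : exists2 t : R, 0 < t & forall i, i \in enum I -> P i t.
  by exists t => // i; apply: ht; rewrite mem_enum.
elim: (enum I) => [|i s [t t0 ht]]; first by exists 1.
have [r r0 hr] := Pex i.
exists (Num.min r t) => [|j]; first by rewrite lt_min r0.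
rewrite inE => /predU1P[->|/ht htj].
  by apply: Pmono hr; rewrite ge_min lexx.
by apply: Pmono htj; rewrite ge_min lexx orbT.
Qed.

Lemma spider_split_r_ge (d : nat) (V : finType) (adj : rel V)
    (x : V) (N1 N2 W : {set V}) (n : nat) :
  simple_graph adj -> minimally_d_rigid adj d ->
  spider_partition adj d x N1 N2 W ->
  r_ge adj d n -> r_ge (spider_split adj x N1 N2 W) d n.
Proof.
move=> simple minrig part [p [gp [qs [pqs ncong]]]].
have [_ irr] := simple; have [_ _ _ _ cardW] := part.
pose w (j : 'I_d) : V := enum_val (cast_ord (esym cardW) j).
have w_inj : injective w by move=> i j /enum_val_inj/cast_ord_inj.
have wW j : w j \in W by exact: enum_valP.
have w_x j : w j != x.
  apply: contraTneq (wW j) => ->; apply/negP => xW.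
  by have := irr x; rewrite (spider_part_adj part) // !inE xW !orbT.
pose q' i := double_point x (qs i).
have indep i : edge_independent (spider_split adj x N1 N2 W) (q' i).
  apply: (spider_split_independent simple part) => [|c].
    apply: (equivalent_edge_independent simple gp (pqs i)) => a b ab.
    have [[p0 [gp0 rig0]] min] := minrig.
    by apply: edge_length_transcendental gp0 rig0 _; exact: min.
  have [y hy] := star_solve
    (star_det_nonvanishing w_inj w_x simple minrig gp (pqs i)) (fun j => c (w j)).
  exists y => v vW; have [j ->] : exists j, v = w j; last exact: hy.
  exists (cast_ord cardW (enum_rank_in vW v)).
  by rewrite /w cast_ordK enum_rankK_in.
(* Non-congruent realisations differ in some squared distance; moving each value by less than half
   the gap keeps them apart. *)
have [e e0 he] : exists2 e : R, 0 < e & forall ij : 'I_n * 'I_n, ij.1 != ij.2 ->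
    forall r1 r2 : realisation (option V) d,
    (forall a k, `|r1 a ord0 k - q' ij.1 a ord0 k| < e) ->
    (forall a k, `|r2 a ord0 k - q' ij.2 a ord0 k| < e) -> ~ congruent r1 r2.
  apply: common_radius => [ij s t st ht neq r1 r2 h1 h2|[i j] /=].
    by apply: (ht neq) => a k; apply: lt_le_trans st.
  have [->|neq] := eqVneq i j; first by exists 1.
  have [u [v uv]] : exists u v, sqdist (qs i) u v <> sqdist (qs j) u v.
    apply: contrapT => h; apply: (ncong _ _ neq); apply/congruent_sqdist => u v.
    by apply: contrapT => uv; apply: h; exists u, v.
  set s := sqdist (qs i) u v in uv; set t := sqdist (qs j) u v in uv.
  have st0 : 0 < `|s - t| / 2.
    by rewrite divr_gt0 // normr_gt0 subr_eq0; apply/eqP.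
  have [r r0 hr] := sqdist_continuous (q' i) st0.
  have [r' r'0 hr'] := sqdist_continuous (q' j) st0.
  exists (Num.min r r') => [|_ r1 r2 h1 h2 /congruent_sqdist/(_ (Some u) (Some v)) h].
    by rewrite lt_min r0.
  have {}h1 : `|sqdist r1 (Some u) (Some v) - s| < `|s - t| / 2.
    by apply: hr => a k; have := h1 a k; rewrite lt_min => /andP[].
  have {}h2 : `|sqdist r2 (Some u) (Some v) - t| < `|s - t| / 2.
    by apply: hr' => a k; have := h2 a k; rewrite lt_min => /andP[].
  rewrite -h in h2; have := ler_distD (sqdist r1 (Some u) (Some v)) s t.
  rewrite distrC in h1; move/le_lt_trans/(_ (ltrD h1 h2)).
  by rewrite -splitr ltxx.
have [t t0 ht] : exists2 t : R, 0 < t & forall i (y : option V -> option V -> R),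
    (forall u v, y u v = y v u) ->
    (forall u v, spider_split adj x N1 N2 W u v -> `|y u v - sqdist (q' i) u v| < t) ->
    exists2 r : realisation (option V) d,
      (forall a k, `|r a ord0 k - q' i a ord0 k| < e) &
      forall u v, spider_split adj x N1 N2 W u v -> sqdist r u v = y u v.
  apply: common_radius => [i s t st ht y ysym yq|i].
    by apply: ht => // u v /yq h; apply: lt_le_trans st.
  have sym' : ssrbool.symmetric (spider_split adj x N1 N2 W) by exact: spider_split_sym.
  exact: edge_local_surjectivity sym' _ (indep i) _ e0.
have [s s0 hs] := sqdist_continuous (double_point x p) t0.
have [p' gp' pp'] := generic_dense (double_point x p) s0.
exists p'; split=> //.
have [i|rs hrs] := choice (P := fun i (r : realisation (option V) d) =>
    (forall a k, `|r a ord0 k - q' i a ord0 k| < e) /\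
    forall u v, spider_split adj x N1 N2 W u v -> sqdist r u v = sqdist p' u v).
  (* On edges of the split graph, the lengths of [p'] are close to those of the doubled [p], which
     agree with those of [q' i]. *)
  have [u v|u v uv|r h1 h2] := ht i (sqdist p'); first exact: sqdistC.
    by rewrite -(double_point_equivalent simple part (pqs i) uv); exact: hs.
  by exists r.
exists rs; split=> [i|i j ij].
  by apply/equivalent_sqdist => u v /(hrs i).2.
exact: (he (i, j) ij _ _ (hrs i).1 (hrs j).1).
Qed.

Local Close Scope ring_scope.

Theorem theorem4p14 (d : nat) (V : finType) (adj : rel V)
    (x : V) (N1 N2 W : {set V}) :
  simple_graph adj ->
  minimally_d_rigid adj d ->
  d.+1 <= #|V| ->
  spider_partition adj d x N1 N2 W ->
  forall n : nat, r_ge adj d n -> r_ge (spider_split adj x N1 N2 W) d n.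
Proof.
by move=> simple minrig _ part n; exact: spider_split_r_ge.
Qed.
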